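(* Let $\epsilon>0$, let $C$ be an $N\times N$ cost matrix, and let $\tilde{\mathbf{C}}$ be the $(\mathcal{T}+2)$-mode tensor $\tilde{\mathbf{C}}^{(\ell i_0\ldots i_{\mathcal{T}})}=\sum_{j=0}^{\mathcal{T}-1}C^{(i_j,i_{j+1})}$, $\ell\in\{1,\dots,L\}$, $i_0,\dots,i_{\mathcal{T}}\in\{1,\dots,N\}$. Let $\mathbf{K}=\exp(-\tilde{\mathbf{C}}/\epsilon)$ and let $\mathbf{U}$ be the tensor $$\mathbf{U}^{(\ell i_0\ldots i_{\mathcal{T}})}=U_{-1,0}^{(\ell,i_0)}\prod_{j=1}^{\mathcal{T}}U_{-1,j}^{(\ell,i_j)}\prod_{j=1}^{\mathcal{T}}u_j^{(i_j)},$$ where $U_{-1,0},\dots,U_{-1,\mathcal{T}}\in\mathbb{R}_+^{L\times N}$ and $u_1,\dots,u_{\mathcal{T}}\in\mathbb{R}_+^N$. Define $K=\exp(-C/\epsilon)$, and let $$\hat\Psi_j=\begin{cases}U_{-1,0}K,& j=1,\\ \big(\hat\Psi_{j-1}\odot U_{-1,j-1}\big)\,\mathrm{diag}(u_{j-1})K,& j=2,\dots,\mathcal{T},\end{cases}$$ $$\Psi_j=\begin{cases}U_{-1,\mathcal{T}}\,\mathrm{diag}(u_{\mathcal{T}})K^T,& j=\mathcal{T}-1,\\ \big(\Psi_{j+1}\odot U_{-1,j+1}\big)\,\mathrm{diag}(u_{j+1})K^T,& j=0,\dots,\mathcal{T}-2.\end{cases}$$ Then $$\begin{aligned} P_{-1,0}(\mathbf{K}\odot\mathbf{U})&=U_{-1,0}\odot\Psi_0,\\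 P_{-1,j}(\mathbf{K}\odot\mathbf{U})&=\hat\Psi_j\odot\Psi_j\odot \big(U_{-1,j}\,\mathrm{diag}(u_j)\big),\\ P_{-1,\mathcal{T}}(\mathbf{K}\odot\mathbf{U})&=\big(U_{-1,\mathcal{T}}\,\mathrm{diag}(u_{\mathcal{T}})\big)\odot\hat\Psi_{\mathcal{T}},\\ P_{\mathcal{T}}(\mathbf{K}\odot\mathbf{U})&=u_{\mathcal{T}}\odot\big(\hat\Psi_{\mathcal{T}}\odot U_{-1,\mathcal{T}}\big)^T\mathbf{1},\\ P_j(\mathbf{K}\odot\mathbf{U})&=u_j\odot\big(\hat\Psi_j\odot\Psi_j\odot U_{-1,j}\big)^T\mathbf{1}, \end{aligned}$$ for $j=1,\dots,\mathcal{T}-1$.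
   Context: $L,N,\mathcal{T}\ge1$ are integers. Tensors have $\mathcal{T}+2$ modes, indexed by $-1,0,1,\dots,\mathcal{T}$: mode $-1$ has index $\ell\in\{1,\dots,L\}$ and mode $j\in\{0,\dots,\mathcal{T}\}$ has index $i_j\in\{1,\dots,N\}$. $\exp$ is applied elementwise, $\odot$ is the elementwise product, $\mathrm{diag}(u)$ is the diagonal matrix with diagonal $u$, and $\mathbf{1}$ is the vector of ones (here in $\mathbb{R}^L$). For a tensor $\mathbf{M}$, $P_j(\mathbf{M})\in\mathbb{R}^N$ is the vector whose element $i_j$ is the sum of $\mathbf{M}^{(\ell i_0\ldots i_{\mathcal{T}})}$ over all indices except $i_j$, and $P_{-1,j}(\mathbf{M})\in\mathbb{R}^{L\times N}$ is the matrix whose element $(\ell,i_j)$ is the sum of $\mathbf{M}^{(\ell i_0\ldots i_{\mathcal{T}})}$ over all indices except $\ell$ and $i_j$. *)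

(* Defs.v *)
From HB Require Import structures.
From mathcomp Require Export all_boot all_order all_algebra.
From mathcomp Require Export reals sequences exp.

Set Implicit Arguments.
Unset Strict Implicit.
Unset Printing Implicit Defensive.

Import Order.TTheory GRing.Theory Num.Theory.
Local Open Scope ring_scope.

(* Mode -1 is the 'I_L argument; modes 0, ..., T are the coordinates of the
   multi-index i : {ffun 'I_T.+1 -> 'I_N}. *)
Definition tensor (R : Type) (L N T : nat) : Type :=
  'I_L -> {ffun 'I_T.+1 -> 'I_N} -> R.

Definition tmul (R : realType) (L N T : nat) (A B : tensor R L N T) :
  tensor R L N T := fun l i => A l i * B l i.

Definition hadamard (R : realType) (m n : nat) (A B : 'M[R]_(m, n)) :
  'M[R]_(m, n) := map2_mx *%R A B.

Notation "A ⊙ B" := (hadamard A B)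
  (at level 40, left associativity) : ring_scope.

(* P_j(M), as a column vector. *)
Definition proj (R : realType) (L N T : nat) (j : 'I_T.+1)
    (M : tensor R L N T) : 'cV[R]_N :=
  \col_(k < N) \sum_(l < L) \sum_(i : {ffun 'I_T.+1 -> 'I_N} | i j == k) M l i.

(* P_{-1,j}(M). *)
Definition biproj (R : realType) (L N T : nat) (j : 'I_T.+1)
    (M : tensor R L N T) : 'M[R]_(L, N) :=
  \matrix_(l < L, k < N)
     \sum_(i : {ffun 'I_T.+1 -> 'I_N} | i j == k) M l i.

(* For j : 'I_T, widen_ord (leqnSn T) j and lift ord0 j are the modes
   j and j+1 in 'I_T.+1. *)
Definition cost_tensor (R : realType) (L N T : nat) (C : 'M[R]_N) :
    tensor R L N T :=
  fun _ i => \sum_(j < T) C (i (widen_ord (leqnSn T) j)) (i (lift ord0 j)).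

Definition kernel_tensor (R : realType) (L N T : nat) (eps : R)
    (C : 'M[R]_N) : tensor R L N T :=
  fun l i => expR (- cost_tensor C l i / eps).

Definition kernel_mx (R : realType) (N : nat) (eps : R) (C : 'M[R]_N) :
  'M[R]_N := \matrix_(a, b) expR (- C a b / eps).

(* Families are indexed by nat: U j stands for U_{-1,j}, 0 <= j <= T, and
   u j for u_j, 1 <= j <= T; values outside these ranges are never used. *)
Definition scaling_tensor (R : realType) (L N T : nat)
    (U : nat -> 'M[R]_(L, N)) (u : nat -> 'cV[R]_N) : tensor R L N T :=
  fun l i =>
    U 0%N l (i ord0)
    * (\prod_(j < T) U j.+1 l (i (lift ord0 j)))
    * (\prod_(j < T) u j.+1 (i (lift ord0 j)) 0).

(* \hat\Psi_j for j >= 1; the value at j = 0 is a dummy. *)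
Fixpoint psi_hat (R : realType) (L N : nat) (K : 'M[R]_N)
    (U : nat -> 'M[R]_(L, N)) (u : nat -> 'cV[R]_N) (j : nat) :
    'M[R]_(L, N) :=
  match j with
  | 0 => 0
  | 1 => U 0%N *m K
  | S (S _ as j') =>
      (psi_hat K U u j' ⊙ U j') *m diag_mx (u j')^T *m K
  end.

(* The backward recursion, by distance to the end:
   psi_rev k = \Psi_{T-1-k} for 0 <= k <= T-1. *)
Fixpoint psi_rev (R : realType) (L N T : nat) (K : 'M[R]_N)
    (U : nat -> 'M[R]_(L, N)) (u : nat -> 'cV[R]_N) (k : nat) :
    'M[R]_(L, N) :=
  match k with
  | 0 => U T *m diag_mx (u T)^T *m K^T
  | S k' =>
      (psi_rev T K U u k' ⊙ U (T - k)%N) *m diag_mx (u (T - k)%N)^T *m K^T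
  end.

Definition psi (R : realType) (L N T : nat) (K : 'M[R]_N)
    (U : nat -> 'M[R]_(L, N)) (u : nat -> 'cV[R]_N) (j : nat) :
    'M[R]_(L, N) := psi_rev T K U u (T.-1 - j).

Section Recursions.
Variables (R : realType) (L N T : nat) (K : 'M[R]_N).
Variables (U : nat -> 'M[R]_(L, N)) (u : nat -> 'cV[R]_N).

Lemma psi_hat1 : psi_hat K U u 1 = U 0%N *m K.
Proof. by []. Qed.

Lemma psi_hatE j : (2 <= j <= T)%N ->
  psi_hat K U u j =
  (psi_hat K U u j.-1 ⊙ U j.-1) *m diag_mx (u j.-1)^T *m K.
Proof. by case: j => [|[|j]]. Qed.

Lemma psi_last : psi T K U u T.-1 = U T *m diag_mx (u T)^T *m K^T.
Proof. by rewrite /psi subnn. Qed.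

Lemma psiE j : (j.+2 <= T)%N ->
  psi T K U u j =
  (psi T K U u j.+1 ⊙ U j.+1) *m diag_mx (u j.+1)^T *m K^T.
Proof.
case: T => [//|t]; rewrite ltnS /psi => ltjt.
rewrite -[(t.+1.-1 - j)%N](@subnSK j t) //=.
by rewrite subSS subKn.
Qed.
End Recursions.

(* Main.v *)
Require Import Defs.

Set Implicit Arguments.
Unset Strict Implicit.
Unset Printing Implicit Defensive.

Import Order.TTheory GRing.Theory Num.Theory.
Local Open Scope ring_scope.

(** For a fixed [l] the tensor [KU l] is a product of node weights [w j (i_j)]
    and edge weights [K i_j i_{j+1}] along the chain [i_0, ..., i_T]. Fixing
    [i_j = k] splits the sum into a product of the weight of the node [k], the
    sum over the left part of the chain and the sum over the right part; each
    of these satisfies a one-step (transfer matrix) recursion, which is that of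
    [psi_hat], resp. [psi]. The left part is dealt with by repeatedly summing
    over [i_0] and absorbing the result into the weight of [i_1]. *)

Definition ffun_cons (A : finType) n (a : A) (i : {ffun 'I_n -> A}) :
    {ffun 'I_n.+1 -> A} :=
  [ffun j => if unlift ord0 j is Some j' then i j' else a].

Lemma ffun_cons0 (A : finType) n (a : A) (i : {ffun 'I_n -> A}) :
  ffun_cons a i ord0 = a.
Proof. by rewrite ffunE unlift_none. Qed.

Lemma ffun_consS (A : finType) n (a : A) (i : {ffun 'I_n -> A}) j :
  ffun_cons a i (lift ord0 j) = i j.
Proof. by rewrite ffunE liftK. Qed.

Lemma big_ffun_cons (R : nmodType) (A : finType) n
    (P : pred {ffun 'I_n.+1 -> A}) (F : {ffun 'I_n.+1 -> A} -> R) :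
  \sum_(i | P i) F i =
  \sum_a \sum_(i : {ffun 'I_n -> A} | P (ffun_cons a i)) F (ffun_cons a i).
Proof.
rewrite pair_big_dep /=.
rewrite (reindex (fun p : A * {ffun 'I_n -> A} => ffun_cons p.1 p.2)) //=.
exists (fun i => (i ord0, [ffun j => i (lift ord0 j)])) => [[a i]|i] _ /=.
  by rewrite ffun_cons0; congr pair; apply/ffunP=> j; rewrite ffunE ffun_consS.
apply/ffunP=> j; case: (unliftP ord0 j) => [j'|] ->.
  by rewrite ffun_consS ffunE.
by rewrite ffun_cons0.
Qed.

Section Chain.
Variables (R : comNzRingType) (A : finType) (K : A -> A -> R).
Implicit Type w : nat -> A -> R.

Definition chain_weight n w (i : {ffun 'I_n.+1 -> A}) : R :=
  (\prod_(j < n.+1) w j (i j)) *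
  \prod_(j < n) K (i (widen_ord (leqnSn n) j)) (i (lift ord0 j)).

Definition chain_sum n w (j : 'I_n.+1) (k : A) : R :=
  \sum_(i : {ffun 'I_n.+1 -> A} | i j == k) chain_weight w i.

Fixpoint left_sum w (j : nat) (k : A) : R :=
  if j is j'.+1 then \sum_a left_sum w j' a * w j' a * K a k else 1.

(* The chain continues for [n] more nodes after node [j]. *)
Fixpoint right_sum w (j n : nat) (k : A) : R :=
  if n is n'.+1 then \sum_b K k b * (w j.+1 b * right_sum w j.+1 n' b) else 1.

(** Weights of the chain that remains once node 0 is summed out: indices shift down by one, and the
    new first node takes over the sum over $i_0$. *)
Definition absorb w (j : nat) (k : A) : R :=
  if j is 0 then (\sum_a w 0%N a * K a k) * w 1%N k else w j.+1 k.

Lemma chain_weight_cons n w a (i : {ffun 'I_n.+1 -> A}) :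
  chain_weight w (ffun_cons a i) =
  w 0%N a * K a (i ord0) * chain_weight (fun j => w j.+1) i.
Proof.
rewrite /chain_weight big_ord_recl [X in _ * X = _]big_ord_recl.
have -> : widen_ord (leqnSn n.+1) ord0 = ord0 by apply: val_inj.
rewrite ffun_consS !ffun_cons0 mulrACA; congr (_ * (_ * _)).
  by apply: eq_bigr => j _; rewrite ffun_consS.
apply: eq_bigr => j _; rewrite ffun_consS.
have -> : widen_ord (leqnSn n.+1) (lift ord0 j) =
          lift ord0 (widen_ord (leqnSn n) j) by apply: val_inj.
by rewrite ffun_consS.
Qed.

(** The constraint leaves $i_0$ free, and $i_0$ enters only through its own weight and the edge to
    $i_1$, so its sum factors out. *)
Lemma chain_sumS n w (j : 'I_n.+1) k :
  chain_sum w (lift ord0 j) k = chain_sum (absorb w) j k.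
Proof.
rewrite /chain_sum big_ffun_cons.
under eq_bigr do under eq_bigl do rewrite ffun_consS.
rewrite exchange_big; apply: eq_bigr => i _ /=.
under eq_bigr do rewrite chain_weight_cons.
rewrite -big_distrl /= /chain_weight [X in _ * (X * _) = _]big_ord_recl.
by rewrite [in RHS]big_ord_recl /= !mulrA.
Qed.

(** The offset [p] makes the induction go through: the tail of the chain is again of this form, with
    offset [p.+1]. *)
Lemma chain_sum0 n w p k :
  chain_sum (fun j => w (p + j)%N) (ord0 : 'I_n.+1) k =
  w p k * right_sum w p n k.
Proof.
elim: n p k => [|n IHn] p k; rewrite /chain_sum big_ffun_cons (bigD1 k) //=.
- rewrite [X in _ + X]big1 ?addr0 => [|a /negPf neq_ak]; last first.
    by apply: big_pred0 => i; rewrite ffun_cons0.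
  have i0 : {ffun 'I_0 -> A} by apply: finfun; case.
  rewrite (big_pred1 i0) => [|i]; last first.
    rewrite ffun_cons0 eqxx; symmetry; apply/eqP.
    by apply/ffunP; case.
  by rewrite /chain_weight big_ord1 big_ord0 ffun_cons0 addn0.
rewrite [X in _ + X]big1 ?addr0 => [|a /negPf neq_ak]; last first.
  by apply: big_pred0 => i; rewrite ffun_cons0.
under eq_bigl do rewrite ffun_cons0 eqxx.
(* Grouping the tails by their first value [b] makes each group a [chain_sum] at [ord0], as in
   [IHn]. *)
rewrite (partition_big (fun i : {ffun 'I_n.+1 -> A} => i ord0) predT) //=.
rewrite big_distrr; apply: eq_bigr => b _ /=.
rewrite -IHn /chain_sum !big_distrr /=; apply: eq_bigr => i /eqP <-.
rewrite chain_weight_cons addn0 mulrA; congr (_ * (_ * _)).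
by apply: eq_bigr => j _; rewrite addnS addSn.
Qed.

(** Only the products with the node weight agree: at [j = 0] the sum over $i_0$ sits in the weight
    on the left-hand side and in [left_sum] on the right-hand side. *)
Lemma left_sum_absorb w j k :
  left_sum (absorb w) j k * absorb w j k = left_sum w j.+1 k * w j.+1 k.
Proof.
elim: j k => [|j IHj] k /=.
  by rewrite mul1r; under [in RHS]eq_bigr do rewrite mul1r.
by congr (_ * _); apply: eq_bigr => a _; rewrite IHj.
Qed.

(** [right_sum] at [j] reads only weights of index above [j], where [absorb] is a plain shift. *)
Lemma right_sum_absorb w j n k :
  right_sum (absorb w) j n k = right_sum w j.+1 n k.
Proof.
by elim: n j k => [//|n IHn] j k /=; apply: eq_bigr => b _; rewrite IHn.
Qed.

Lemma chain_sumE n w (j : 'I_n.+1) k :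
  chain_sum w j k = left_sum w j k * w j k * right_sum w j (n - j) k.
Proof.
elim: n w j => [|n IHn] w j; case: (unliftP ord0 j) => [j'|] ->.
- by case: j'.
- by rewrite (chain_sum0 _ w 0) /= mul1r.
- by rewrite chain_sumS IHn left_sum_absorb right_sum_absorb lift0 subSS.
- by rewrite (chain_sum0 _ w 0) mul1r subn0.
Qed.

End Chain.

Section Scaling.
Variables (R : realType) (L N : nat) (K : 'M[R]_N).
Variables (U : nat -> 'M[R]_(L, N)) (u : nat -> 'cV[R]_N).

Definition scaling_weight (l : 'I_L) (j : nat) (k : 'I_N) : R :=
  if j is 0 then U 0%N l k else U j l k * u j k 0.

Lemma mul_mx_diag_tr m (B : 'M[R]_(m, N)) (v : 'cV[R]_N) l k :
  (B *m diag_mx v^T) l k = B l k * v k 0.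
Proof. by rewrite mul_mx_diag !mxE. Qed.

Lemma scaling_weight_gt0 l j k : (0 < j)%N ->
  scaling_weight l j k = U j l k * u j k 0.
Proof. by case: j. Qed.

(** The induction starts at 1, since at 0 [psi_hat] is the dummy 0 whereas the empty left sum is
    1. *)
Lemma psi_hat_left_sum l j k : (0 < j)%N ->
  psi_hat K U u j l k = left_sum K (scaling_weight l) j k.
Proof.
case: j => // j _; elim: j k => [|j IHj] k.
  by rewrite psi_hat1 mxE; apply: eq_bigr => a _; rewrite mul1r.
rewrite (@psi_hatE _ _ _ j.+2) ?leqnn // mxE; apply: eq_bigr => a _.
by rewrite mul_mx_diag_tr mxE IHj mulrA.
Qed.

(** [psi_rev] at [n] belongs to node [T - n.+1], which has [n.+1] nodes after it; multiplying by
    [K^T] sums over the next node. *)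
Lemma psi_rev_right_sum T l n k : (n < T)%N ->
  psi_rev T K U u n l k =
  right_sum K (scaling_weight l) (T - n.+1) n.+1 k.
Proof.
elim: n k => [|n IHn] k ltnT.
  rewrite mxE; apply: eq_bigr => b _; rewrite mul_mx_diag_tr mxE.
  by rewrite mulr1 mulrC subnSK // subn0 scaling_weight_gt0.
rewrite [LHS]mxE; apply: eq_bigr => b _; rewrite mul_mx_diag_tr mxE.
rewrite IHn 1?ltnW // mulrC subnSK // mxE; congr (_ * _).
by rewrite scaling_weight_gt0 ?subn_gt0 // -mulrA mulrC.
Qed.

Lemma psi_right_sum T l j k : (j < T)%N ->
  psi T K U u j l k = right_sum K (scaling_weight l) j (T - j) k.
Proof.
case: T => // T; rewrite ltnS => lejT.
by rewrite /psi psi_rev_right_sum ?ltnS ?leq_subr // subSS subKn // subSn.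
Qed.

End Scaling.

Lemma kernel_scaling_chain (R : realType) (L N T : nat) (eps : R)
    (C : 'M[R]_N) (U : nat -> 'M[R]_(L, N)) (u : nat -> 'cV[R]_N) l
    (i : {ffun 'I_T.+1 -> 'I_N}) :
  tmul (kernel_tensor eps C) (scaling_tensor U u) l i =
  chain_weight (kernel_mx eps C) (scaling_weight U u l) i.
Proof.
rewrite /tmul mulrC; congr (_ * _).
  rewrite [RHS]big_ord_recl /scaling_tensor -mulrA -big_split.
  by congr (_ * _).
(* The exponential turns the sum of edge costs into the product of edge weights. *)
rewrite /kernel_tensor /cost_tensor -sumrN mulr_suml expR_sum.
by apply: eq_bigr => j _; rewrite mxE.
Qed.

Lemma biprojE (R : realType) (L N T : nat) (eps : R) (C : 'M[R]_N)
    (U : nat -> 'M[R]_(L, N)) (u : nat -> 'cV[R]_N) (j : 'I_T.+1) l k :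
  let K := kernel_mx eps C in
  let w := scaling_weight U u l in
  biproj j (tmul (kernel_tensor eps C) (scaling_tensor U u)) l k =
  left_sum K w j k * w j k * right_sum K w j (T - j) k.
Proof.
move=> K w; rewrite mxE -chain_sumE.
by apply: eq_bigr => i _; rewrite kernel_scaling_chain.
Qed.

Lemma proj_biproj (R : realType) (L N T : nat) (j : 'I_T.+1)
    (M : tensor R L N T) :
  proj j M = (biproj j M)^T *m const_mx 1.
Proof.
by apply/colP=> k; rewrite !mxE; apply: eq_bigr => l _; rewrite !mxE mulr1.
Qed.

(** The diagonal factor scales whole columns of [B], so it comes out of the column sums. *)
Lemma tr_mul_diag_const1 (R : realType) (L N : nat) (B : 'M[R]_(L, N))
    (v : 'cV[R]_N) :
  (B *m diag_mx v^T)^T *m const_mx 1 = v ⊙ (B^T *m const_mx 1) :> 'cV_N.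
Proof.
apply/colP=> k; rewrite !mxE big_distrr; apply: eq_bigr => l _ /=.
by rewrite mxE mul_mx_diag_tr !mxE !mulr1 mulrC.
Qed.

Theorem theorem4p2 (R : realType) (L N T : nat)
    (hL : (1 <= L)%N) (hN : (1 <= N)%N) (hT : (1 <= T)%N)
    (eps : R) (heps : 0 < eps) (C : 'M[R]_N)
    (U : nat -> 'M[R]_(L, N)) (u : nat -> 'cV[R]_N)
    (hU : forall j : nat, (j <= T)%N ->
            forall (l : 'I_L) (i : 'I_N), 0 <= U j l i)
    (hu : forall j : nat, (1 <= j <= T)%N -> forall i : 'I_N, 0 <= u j i 0) :
  let KU : tensor R L N T :=
    tmul (kernel_tensor eps C) (scaling_tensor U u) in
  let K : 'M[R]_N := kernel_mx eps C in
  let hPsi : nat -> 'M[R]_(L, N) := psi_hat K U u in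
  let Psi : nat -> 'M[R]_(L, N) := psi T K U u in
  let one : 'cV[R]_L := const_mx 1 in
  [/\ biproj ord0 KU = U 0%N ⊙ Psi 0%N,
      forall j : 'I_T.+1, (1 <= j <= T - 1)%N ->
        biproj j KU = hPsi j ⊙ Psi j ⊙ (U j *m diag_mx (u j)^T),
      biproj ord_max KU = (U T *m diag_mx (u T)^T) ⊙ hPsi T,
      proj ord_max KU = u T ⊙ ((hPsi T ⊙ U T)^T *m one)
    & forall j : 'I_T.+1, (1 <= j <= T - 1)%N ->
        proj j KU = u j ⊙ ((hPsi j ⊙ Psi j ⊙ U j)^T *m one)].
Proof.
move=> KU K hPsi Psi one.
(* With the diagonal factor outermost, [tr_mul_diag_const1] applies directly for [proj]; the form
   stated for [biproj] is an entrywise regrouping. *)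
have mid (j : 'I_T.+1) : (1 <= j <= T - 1)%N ->
    biproj j KU = (hPsi j ⊙ Psi j ⊙ U j) *m diag_mx (u j)^T.
  case/andP=> j_gt0 ltjT; apply/matrixP=> l k.
  rewrite biprojE mul_mx_diag_tr !mxE psi_right_sum; last first.
    by rewrite (leq_ltn_trans ltjT) // subn1 ltn_predL.
  by rewrite psi_hat_left_sum // scaling_weight_gt0 // mulrA mulrAC
    [X in X * _ = _]mulrAC.
have last : biproj ord_max KU = (hPsi T ⊙ U T) *m diag_mx (u T)^T.
  apply/matrixP=> l k; rewrite biprojE subnn mulr1 mul_mx_diag_tr mxE /=.
  by rewrite psi_hat_left_sum // scaling_weight_gt0 // mulrA.
split=> [|j hj|||j hj].
(* At node 0 the left sum is empty, hence 1, and the node weight is [U 0] alone. *)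
- by apply/matrixP=> l k; rewrite biprojE mul1r mxE psi_right_sum // subn0.
- apply/matrixP=> l k; rewrite mid // mul_mx_diag_tr ![(_ ⊙ _) l k]mxE.
  by rewrite mul_mx_diag_tr mulrA.
- apply/matrixP=> l k; rewrite last mul_mx_diag_tr ![(_ ⊙ _) l k]mxE.
  by rewrite mul_mx_diag_tr -mulrA mulrC.
- by rewrite proj_biproj last tr_mul_diag_const1.
- by rewrite proj_biproj mid // tr_mul_diag_const1.
Qed.
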